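(* Let $m\ge1$, $n\ge1$ be integers, let $a_m$ be a real constant, let $N=nm+1$, and let $\{k_1,\dots,k_N\}$ be a set of $N$ (distinct) integers with Lagrange polynomials $L_i(x)=\prod_{j\ne i}\frac{x-k_j}{k_i-k_j}$. Consider the $n$th-order time-marching scheme $$u(x,\Delta t)=\sum_{i=1}^{N}c_i\,u(x+k_i\Delta x,0),\qquad c_i=\sum_{j=0}^n\frac{\nu_m^j}{j!}L_i^{(jm)}(0),\qquad \nu_m=\frac{\Delta t\,a_m}{\Delta x^m},$$ for solving $\partial u/\partial t=a_m\partial_x^m u$, applied to a smooth solution $u$. Then the scheme approximates all spatial derivatives $u^{(jm)}(x,0)$, $j=0,1,\dots,n$, uniformly to order $\Delta x^{nm}$, in the sense that for every $0\le j\le n$ $$\sum_{i=1}^N L_i^{(jm)}(0)\,u(x+k_i\Delta x,0)=\Delta x^{jm}\,u^{(jm)}(x,0)+O(\Delta x^{nm+1}).$$ Moreover, its overall local error $E$ (the value given by the scheme minus the exact solution at time $\Delta t$) is $$E=\Delta x^{N}\Bigl(\sum_{j=0}^n\frac{\nu_m^j}{j!}P^{(jm)}(0)\Bigr)\frac{u^{(N)}(x,0)}{N!}+\Delta x^{N+1}\Bigl(\sum_{j=0}^n\frac{\nu_m^j}{j!}Q^{(jm)}(0)\Bigr)\frac{u^{(N+1)}(x,0)}{(N+1)!}-(\Delta t\,a_m)^{n+1}\frac{u^{((n+1)m)}(x,0)}{(n+1)!},$$ up to the omitted higher-order remainder terms $\sum_{j=0}^n\frac{\nu_m^j}{j!}\,O(\Delta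 x^{N+2})+O(\Delta t^{\,n+2})$, where $$P(x)=x^N-s(x),\qquad Q(x)=x^{N+1}-\Bigl(x+\sum_{i=1}^N k_i\Bigr)s(x),\qquad s(x)=\prod_{i=1}^N(x-k_i).$$ The local truncation error is $E/\Delta t$.
   Context: Here $u^{(\ell)}(x,0)$ denotes the $\ell$th derivative of $u$ with respect to $x$ at $(x,0)$; $L_i^{(\ell)}$, $P^{(\ell)}$, $Q^{(\ell)}$ denote $\ell$th derivatives of polynomials. $\Delta t,\Delta x>0$ are the time step and grid spacing. The exact solution is formally $u(x,\Delta t)=e^{\Delta t\,a_m\partial_x^m}u(x,0)=\sum_{j\ge0}\frac{(\Delta t\,a_m)^j}{j!}u^{(jm)}(x,0)$; $u$ is assumed to be as smooth in $x$ and $t$ as needed, and $x$ is fixed. The $O$-constants depend only on $u$, $x$, the $k_i$, $m$, $n$, $a_m$. *)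

(* Defs.v *)
(* Analysis is Coquelicot's, on the Stdlib reals; polynomials are MathComp's
   {poly R}, over the same R through its field structure in Rstruct. *)
From Stdlib Require Import Reals.
From Coquelicot Require Import Derive Derive_2d Continuity Hierarchy.
From mathcomp Require Import all_boot all_order all_algebra.
From mathcomp Require Import Rstruct.

Set Implicit Arguments.
Unset Strict Implicit.
Unset Printing Implicit Defensive.

Import Order.TTheory GRing.Theory Num.Theory.

(* Since mathcomp is loaded last, %R is ring_scope; it is needed because R_scope
   is bound to the type R and would otherwise take over at that type. *)
Local Open Scope ring_scope.

Definition node (N : nat) (k : 'I_N -> int) (i : 'I_N) : R := ((k i)%:~R)%R.

Definition L_poly (N : nat) (k : 'I_N -> int) (i : 'I_N) : {poly R} :=
  \prod_(j < N | j != i) ((node k i - node k j)^-1 *: ('X - (node k j)%:P)).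

Definition node_poly (N : nat) (k : 'I_N -> int) : {poly R} :=
  \prod_(i < N) ('X - (node k i)%:P).

Definition P_poly (N : nat) (k : 'I_N -> int) : {poly R} :=
  'X^N - node_poly k.

Definition Q_poly (N : nat) (k : 'I_N -> int) : {poly R} :=
  'X^(N.+1) - ('X + (\sum_(i < N) node k i)%:P) * node_poly k.

(* C^oo on the closed half-plane t >= 0 near (x,0), i.e. up to the boundary
   t = 0: u is there the restriction of a function v that is C^oo on a full
   neighbourhood of (x,0).  The values of u for t < 0 are irrelevant. *)
Definition smooth_at_initial (u : R -> R -> R) (x : R) : Prop :=
  exists v : R -> R -> R,
    locally_2d (fun y t => forall q : nat, ex_diff_n v q y t) x 0%R /\
    locally_2d (fun y t => 0 <= t -> u y t = v y t) x 0%R.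

Definition solves_pde (a : R) (m : nat) (u : R -> R -> R) (x : R) : Prop :=
  locally_2d (fun y t => 0 < t ->
    Derive (fun tau => u y tau) t = a * Derive_n (fun z => u z t) m y) x 0%R.

Definition dx0 (u : R -> R -> R) (l : nat) (x : R) : R :=
  Derive_n (fun y => u y 0) l x.

Definition nu (a : R) (m : nat) (dt dx : R) : R := (dt * a / dx ^+ m)%R.

Definition scheme_coef (N m n : nat) (a : R) (k : 'I_N -> int) (dt dx : R)
    (i : 'I_N) : R :=
  (\sum_(0 <= j < n.+1)
    nu a m dt dx ^+ j / j`!%:R * ((L_poly k i)^`(j * m)).[0])%R.

Definition scheme (N m n : nat) (a : R) (k : 'I_N -> int) (u : R -> R -> R)
    (x dt dx : R) : R :=
  (\sum_(i < N) scheme_coef m n a k dt dx i * u (x + node k i * dx) 0)%R.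

Definition local_error (N m n : nat) (a : R) (k : 'I_N -> int)
    (u : R -> R -> R) (x dt dx : R) : R :=
  (scheme m n a k u x dt dx - u x dt)%R.

(* Residual of the exact solution in the scheme written as a discretization
   of the differential equation,
     (U(x,dt) - U(x,0)) / dt = (scheme - U(x,0)) / dt,
   with the same sign convention as [local_error]. *)
Definition truncation_error (N m n : nat) (a : R) (k : 'I_N -> int)
    (u : R -> R -> R) (x dt dx : R) : R :=
  ((scheme m n a k u x dt dx - u x 0) / dt - (u x dt - u x 0) / dt)%R.

Definition bigO0 (f : R -> R) (p : nat) : Prop :=
  exists C : R, at_right 0%R (fun h => `|f h| <= C * h ^+ p).

(* Main.v *)
(* Lagrange interpolation at the nodes k_i is exact on polynomials of degree < N,
   while y^N and y^(N+1) are interpolated by their remainders P and Q modulo the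
   node polynomial s (the factor y + sum k_i in Q cancels the y^N coefficient).
   Hence applying sum_i L_i^(jm)(0) to the Taylor expansion of u(x + k_i dx, 0)
   leaves dx^(jm) u^(jm), a P term, a Q term and an O(dx^(N+2)) remainder.
   The equation gives d_t^j u = a^j d_x^(jm) u at t = 0, so Taylor's formula in t
   yields the sum of (dt a)^j / j! u^(jm) for j <= n+1; since
   nu^j dx^(jm) = (dt a)^j, the terms with j <= n cancel in the error. *)

Require Import Defs.
From Stdlib Require Import Reals Lra.
From Coquelicot Require Import Derive Derive_2d Continuity Hierarchy.
From mathcomp Require Import all_boot all_order all_algebra.
From mathcomp Require Import Rstruct.

Set Implicit Arguments.
Unset Strict Implicit.
Unset Printing Implicit Defensive.

Import Order.TTheory GRing.Theory Num.Theory.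

Local Open Scope R_scope.

(** * Partial derivatives of smooth functions on an open set of the plane *)

Definition Dx (w : R -> R -> R) (y t : R) : R := Derive (fun z => w z t) y.

Definition Dt (w : R -> R -> R) (y t : R) : R := Derive (fun s => w y s) t.

Definition open2 (O : R -> R -> Prop) : Prop :=
  forall y t, O y t -> locally_2d O y t.

Definition smooth_on (O : R -> R -> Prop) (w : R -> R -> R) : Prop :=
  forall y t, O y t -> forall q, ex_diff_n w q y t.

Definition eq_on (O : R -> R -> Prop) (f g : R -> R -> R) : Prop :=
  forall y t, O y t -> f y t = g y t.

Lemma smooth_on_Dx O w : smooth_on O w -> smooth_on O (Dx w).
Proof. by move=> hw y t hO q; have [_ [_ [_ []]]] := hw y t hO q.+1. Qed.

Lemma smooth_on_Dt O w : smooth_on O w -> smooth_on O (Dt w).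
Proof. by move=> hw y t hO q; have [_ [_ [_ []]]] := hw y t hO q.+1. Qed.

Lemma smooth_on_iter_Dx O w l : smooth_on O w -> smooth_on O (iter l Dx w).
Proof. by move=> hw; elim: l => //= l; exact: smooth_on_Dx. Qed.

Lemma smooth_on_iter_Dt O w l : smooth_on O w -> smooth_on O (iter l Dt w).
Proof. by move=> hw; elim: l => //= l; exact: smooth_on_Dt. Qed.

Lemma smooth_on_continuity O w y t :
  smooth_on O w -> O y t -> continuity_2d_pt w y t.
Proof. by move=> hw hO; have [] := hw y t hO 0%N. Qed.

Lemma smooth_on_ex_Dx O w y t :
  smooth_on O w -> O y t -> ex_derive (fun z => w z t) y.
Proof. by move=> hw hO; have [_ []] := hw y t hO 1%N. Qed.

Lemma smooth_on_ex_Dt O w y t :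
  smooth_on O w -> O y t -> ex_derive (fun s => w y s) t.
Proof. by move=> hw hO; have [_ [_ []]] := hw y t hO 1%N. Qed.

Lemma locally_2d_fst O y t :
  locally_2d O y t -> locally y (fun z => O z t).
Proof.
move=> [d hd]; exists d => z hz; apply: hd; first exact: hz.
by rewrite Rminus_diag Rabs_R0; exact: cond_pos.
Qed.

Lemma locally_2d_snd O y t :
  locally_2d O y t -> locally t (fun s => O y s).
Proof.
move=> [d hd]; exists d => z hz; apply: hd; last exact: hz.
by rewrite Rminus_diag Rabs_R0; exact: cond_pos.
Qed.

Lemma eq_on_Dx O f g : open2 O -> eq_on O f g -> eq_on O (Dx f) (Dx g).
Proof.
move=> hO hfg y t yt; apply: Derive_ext_loc.
by apply: filter_imp (locally_2d_fst (hO _ _ yt)) => z; exact: hfg.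
Qed.

Lemma eq_on_Dt O f g : open2 O -> eq_on O f g -> eq_on O (Dt f) (Dt g).
Proof.
move=> hO hfg y t yt; apply: Derive_ext_loc.
by apply: filter_imp (locally_2d_snd (hO _ _ yt)) => z; exact: hfg.
Qed.

Lemma eq_on_iter_Dx O f g l :
  open2 O -> eq_on O f g -> eq_on O (iter l Dx f) (iter l Dx g).
Proof. by move=> hO hfg; elim: l => //= l; exact: eq_on_Dx. Qed.

Lemma Derive_n_Dx w l y t : Derive_n (fun z => w z t) l y = iter l Dx w y t.
Proof. by elim: l y => //= l IH y; apply: Derive_ext. Qed.

Lemma Derive_n_Dt w l y t : Derive_n (fun s => w y s) l t = iter l Dt w y t.
Proof. by elim: l t => //= l IH t; apply: Derive_ext. Qed.

Lemma ex_derive_n_Dx O w l y t :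
  smooth_on O w -> O y t -> ex_derive_n (fun z => w z t) l y.
Proof.
move=> hw yt; case: l => //= l.
apply: (ex_derive_ext (fun z => iter l Dx w z t)).
  by move=> z; rewrite Derive_n_Dx.
exact: smooth_on_ex_Dx (smooth_on_iter_Dx l hw) yt.
Qed.

Lemma ex_derive_n_Dt O w l y t :
  smooth_on O w -> O y t -> ex_derive_n (fun s => w y s) l t.
Proof.
move=> hw yt; case: l => //= l.
apply: (ex_derive_ext (fun s => iter l Dt w y s)).
  by move=> z; rewrite Derive_n_Dt.
exact: smooth_on_ex_Dt (smooth_on_iter_Dt l hw) yt.
Qed.

(** Schwarz's theorem: openness gives the first and mixed derivatives on a whole neighbourhood,
    smoothness the continuity of the mixed ones at the point. *)
Lemma Dt_Dx O w : open2 O -> smooth_on O w -> eq_on O (Dt (Dx w)) (Dx (Dt w)).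
Proof.
move=> hO hw y t yt; symmetry; apply: Schwarz.
- have [d hd] := hO _ _ yt; exists d => z s hz hs; have zs := hd _ _ hz hs.
  split; first exact: smooth_on_ex_Dx hw zs.
  split; first exact: smooth_on_ex_Dt hw zs.
  split; first exact: smooth_on_ex_Dx (smooth_on_Dt hw) zs.
  exact: smooth_on_ex_Dt (smooth_on_Dx hw) zs.
- exact: smooth_on_continuity (smooth_on_Dx (smooth_on_Dt hw)) yt.
- exact: smooth_on_continuity (smooth_on_Dt (smooth_on_Dx hw)) yt.
Qed.

Lemma Dt_iter_Dx O w l : open2 O -> smooth_on O w ->
  eq_on O (Dt (iter l Dx w)) (iter l Dx (Dt w)).
Proof.
move=> hO hw; elim: l => //= l IH y t yt.
rewrite (Dt_Dx hO (smooth_on_iter_Dx l hw) yt).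
exact: eq_on_Dx hO IH _ _ yt.
Qed.

Lemma iter_Dx_scal w c l y t :
  iter l Dx (fun z s => c * w z s) y t = c * iter l Dx w y t.
Proof. by rewrite -!Derive_n_Dx Derive_n_scal_l. Qed.

(** Induction on [j]: on an open set the identity for [j] may be differentiated in time; the new
    [Dt] commutes past the space derivatives, where the equation turns it into [m] more of them and
    a factor [a]. *)
Lemma iter_Dt_pde O w a m j : open2 O -> smooth_on O w ->
  eq_on O (Dt w) (fun y t => a * iter m Dx w y t) ->
  eq_on O (iter j Dt w) (fun y t => a ^ j * iter (j * m) Dx w y t).
Proof.
move=> hO hw hpde; elim: j => [|j IH] y t yt; first by rewrite /=; ring.
rewrite /= (eq_on_Dt hO IH yt) /Dt Derive_scal -/(Dt _ y t).
rewrite (Dt_iter_Dx (j * m) hO hw yt) (eq_on_iter_Dx (j * m) hO hpde yt).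
by rewrite iter_Dx_scal -iterD mulSn addnC; ring.
Qed.

(** * The differentiated equation up to the boundary t = 0 *)

Definition box (x d y t : R) : Prop := Rabs (y - x) < d /\ Rabs t < d.

Definition upper_box (x d y t : R) : Prop := box x d y t /\ 0 < t.

Lemma open2_box x d : open2 (box x d).
Proof.
move=> y t [hy ht].
have hd : 0 < Rmin (d - Rabs (y - x)) (d - Rabs t) by apply: Rmin_case; lra.
exists (mkposreal _ hd) => /= z s hz hs.
have h1 := Rmin_l (d - Rabs (y - x)) (d - Rabs t).
have h2 := Rmin_r (d - Rabs (y - x)) (d - Rabs t).
have h3 := Rabs_triang (z - y) (y - x).
have h4 := Rabs_triang (s - t) t.
have e3 : z - y + (y - x) = z - x by ring.
have e4 : s - t + t = s by ring.
rewrite e3 in h3; rewrite e4 in h4; split; lra.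
Qed.

Lemma open2_upper_box x d : open2 (upper_box x d).
Proof.
move=> y t [/open2_box hb ht].
apply: locally_2d_and hb _; exists (mkposreal _ ht) => /= z s _.
by move=> /Rabs_def2 [] *; lra.
Qed.

(* The equation only holds for t > 0; continuity carries the identity between
   time and space derivatives to the boundary t = 0. *)
Lemma iter_Dt_pde_boundary w a m j x d : 0 < d -> smooth_on (box x d) w ->
  eq_on (upper_box x d) (Dt w) (fun y t => a * iter m Dx w y t) ->
  iter j Dt w x 0 = a ^ j * iter (j * m) Dx w x 0.
Proof.
move=> d0 hw hpde.
have x0 : box x d x 0 by rewrite /box Rminus_diag Rabs_R0.
have hw' : smooth_on (upper_box x d) w by move=> y t [] yt _; exact: hw.
have hj := iter_Dt_pde j (@open2_upper_box x d) hw' hpde.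
set f := iter j Dt w; set g := iter (j * m) Dx w.
have hc : continuity_2d_pt (fun y t => f y t - a ^ j * g y t) x 0.
  apply: continuity_2d_pt_minus.
    exact: smooth_on_continuity (smooth_on_iter_Dt j hw) x0.
  apply: continuity_2d_pt_mult; first exact: continuity_2d_pt_const.
  exact: smooth_on_continuity (smooth_on_iter_Dx _ hw) x0.
set c := f x 0 - a ^ j * g x 0 in hc *.
suff : c = 0 by rewrite /c; lra.
have [//|/Rabs_pos_lt c0] := Req_dec c 0.
(* Continuity is used with tolerance [Rabs c]. At height [Rmin d e / 2] above [x] the difference is
   0, so its distance to [c] is exactly [Rabs c], a contradiction. *)
have [e he] := hc (mkposreal _ c0).
have e0 := cond_pos e.
have hm : 0 < Rmin d e by apply: Rmin_case.
have h1 := Rmin_l d e; have h2 := Rmin_r d e.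
have := he x (Rmin d e / 2).
rewrite Rminus_diag Rabs_R0 => /(_ e0).
rewrite Rminus_0_r (Rabs_pos_eq (Rmin d e / 2)); last lra.
move=> /(_ ltac:(lra)); rewrite /f hj.
  rewrite -/f -/g -/c /=.
  have -> : a ^ j * g x (Rmin d e / 2) - a ^ j * g x (Rmin d e / 2) - c = - c by ring.
  by rewrite Rabs_Ropp => /Rlt_irrefl.
split; last lra; split; first by rewrite Rminus_diag Rabs_R0.
rewrite Rabs_pos_eq; lra.
Qed.

(** * Taylor's formula in one variable and affine changes of variable *)

Definition smooth_near0 (f : R -> R) : Prop :=
  exists d : posreal, forall h, Rabs h < d -> forall l, ex_derive_n f l h.

(** Lagrange form of the remainder: the derivative of order [p.+1] is continuous at 0 because the
    next one exists, hence bounded by [Rabs M + 1] nearby. *)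
Lemma taylor_bound (f : R -> R) (p : nat) : smooth_near0 f ->
  exists C, at_right 0 (fun h =>
    Rabs (f h - sum_f_R0 (fun l => h ^ l / INR (Factorial.fact l) * Derive_n f l 0) p)
      <= C * h ^ p.+1).
Proof.
move=> [d hd].
have hc : continuous (Derive_n f p.+1) 0.
  by apply: ex_derive_continuous; apply: (hd 0 _ p.+2); rewrite Rabs_R0; exact: cond_pos.
set M := Derive_n f p.+1 0.
have [e he] : locally 0 (fun h => Rabs (Derive_n f p.+1 h - M) < 1).
  by apply: (hc (fun z => Rabs (z - M) < 1)); exists (mkposreal 1 Rlt_0_1).
exists ((Rabs M + 1) / INR (Factorial.fact p.+1)).
have hm : 0 < Rmin d e by apply: Rmin_case; exact: cond_pos.
have h1 := Rmin_l d e; have h2 := Rmin_r d e.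
exists (mkposreal _ hm) => h hh h0.
have {}hh : Rabs (h - 0) < Rmin d e by exact: hh.
rewrite Rminus_0_r Rabs_pos_eq in hh; last lra.
have [z [hz ->]] : exists z, 0 < z < h /\ f h =
    sum_f_R0 (fun l => h ^ l / INR (Factorial.fact l) * Derive_n f l 0) p +
    h ^ p.+1 / INR (Factorial.fact p.+1) * Derive_n f p.+1 z.
  have [|z] := @Taylor_Lagrange f p 0 h h0; last by rewrite Rminus_0_r; exists z.
  by move=> t ht l _; apply: hd; rewrite Rabs_pos_eq; lra.
rewrite [X in Rabs X](_ : _ = h ^ p.+1 / INR (Factorial.fact p.+1) * Derive_n f p.+1 z);
  last by ring.
have hF := INR_fact_lt_0 p.+1; have hp := pow_lt h p.+1 h0.
have hz1 : Rabs (Derive_n f p.+1 z - M) < 1.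
  have : Rabs (z - 0) < e by rewrite Rminus_0_r Rabs_pos_eq; lra.
  exact: he.
have hz2 : Rabs (Derive_n f p.+1 z) <= Rabs M + 1.
  have := Rabs_triang (Derive_n f p.+1 z - M) M.
  have -> : Derive_n f p.+1 z - M + M = Derive_n f p.+1 z by ring.
  lra.
have hq : 0 < h ^ p.+1 / INR (Factorial.fact p.+1) by apply: Rdiv_lt_0_compat.
rewrite Rabs_mult Rabs_pos_eq; last lra.
apply: Rle_trans (Rmult_le_compat_l _ _ _ (Rlt_le _ _ hq) hz2) _.
by apply: Req_le; field; apply: not_eq_sym; apply: Rlt_not_eq.
Qed.

(** Chain rule for a translation followed by a scaling; it serves to view the initial data at a
    moving node as a function of the grid spacing. *)
Lemma smooth_affine (g : R -> R) (c x : R) (d : posreal) :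
  (forall y l, Rabs (y - x) < d -> ex_derive_n g l y) ->
  exists e : posreal, forall h l, Rabs h < e ->
    Rabs (c * h) < d /\ ex_derive_n (fun h => g (c * h + x)) l h /\
    Derive_n (fun h => g (c * h + x)) l h = c ^ l * Derive_n g l (c * h + x).
Proof.
move=> hg; set g' := fun y => g (y + x).
have hg' y l : Rabs y < d -> ex_derive_n g' l y.
  by move=> hy; apply: ex_derive_n_comp_trans; apply: hg; rewrite Rplus_minus_r.
have c1 : 0 < Rabs c + 1 by have := Rabs_pos c; lra.
(* The added 1 keeps the radius meaningful for [c = 0], which occurs when 0 is a node. *)
have he : 0 < d / (Rabs c + 1) by apply: Rdiv_lt_0_compat => //; exact: cond_pos.
exists (mkposreal _ he) => h l /= hh.
have hch : Rabs (c * h) < d.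
  rewrite Rabs_mult.
  have : Rabs h * (Rabs c + 1) < d.
    have -> : pos d = d / (Rabs c + 1) * (Rabs c + 1) by field; lra.
    exact: Rmult_lt_compat_r c1 hh.
  have := Rabs_pos h; lra.
have hloc : locally (c * h)
    (fun z => forall k : nat, (k <= l)%coq_nat -> ex_derive_n g' k z).
  have hpos : 0 < d - Rabs (c * h) by lra.
  exists (mkposreal _ hpos) => z /= hz k _; apply: hg'.
  have {}hz : Rabs (z - c * h) < d - Rabs (c * h) by exact: hz.
  have := Rabs_triang (z - c * h) (c * h).
  have -> : z - c * h + c * h = z by ring.
  lra.
split=> //; split; first exact: (ex_derive_n_comp_scal _ _ _ _ hloc).
by rewrite (Derive_n_comp_scal _ _ _ _ hloc) Derive_n_comp_trans.
Qed.

From mathcomp Require Import ring.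

Local Open Scope ring_scope.

(** * Lagrange interpolation and the polynomials P and Q *)

Lemma node_inj N (k : 'I_N -> int) : injective k -> injective (node k).
Proof. by move=> hk i j /intr_inj /hk. Qed.

Lemma L_poly_node N (k : 'I_N -> int) (i j : 'I_N) : injective k ->
  (L_poly k i).[node k j] = (i == j)%:R.
Proof.
move=> /node_inj hk; rewrite horner_prod.
have [<-|ij] := eqVneq.
  rewrite big1 // => l li; rewrite hornerZ hornerXsubC mulVf // subr_eq0.
  by rewrite (inj_eq hk) eq_sym.
by rewrite (bigD1 j) 1?eq_sym //= hornerZ hornerXsubC subrr mulr0 mul0r.
Qed.

Lemma size_L_poly N (k : 'I_N -> int) (i : 'I_N) : (size (L_poly k i) <= N)%N.
Proof.
rewrite /L_poly; apply: leq_trans (size_poly_prod_leq _ _) _.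
(* There are N - 1 factors of size at most 2, and 2(N - 1) + 1 - (N - 1) = N. *)
apply: (@leq_trans ((\sum_(j < N | j != i) 2).+1 - #|[pred j | j != i]|)).
  apply: leq_sub2r; rewrite ltnS; apply: leq_sum => j _.
  by apply: leq_trans (size_scale_leq _ _) _; rewrite size_XsubC.
rewrite sum_nat_const cardC1 card_ord.
by case: N i {k} => [[]//|N] i; rewrite /= muln2 -addnn -addSn addnK.
Qed.

(** The difference of the two sides has size at most [N] and vanishes at [N] distinct nodes. *)
Lemma lagrange_interpolation N (k : 'I_N -> int) (p : {poly R}) :
  injective k -> (size p <= N)%N ->
  \sum_(i < N) p.[node k i] *: L_poly k i = p.
Proof.
move=> hk hp; apply/eqP; rewrite -subr_eq0; apply/eqP.
apply: (@roots_geq_poly_eq0 _ _ [seq node k i | i <- enum 'I_N]).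
- apply/allP => _ /mapP [j _ ->]; rewrite rootE hornerD hornerN horner_sum.
  rewrite (bigD1 j) //= big1 ?hornerZ ?L_poly_node // ?eqxx ?mulr1 ?addr0 ?subrr//.
  by move=> i ij; rewrite hornerZ L_poly_node // (negbTE ij) mulr0.
- by rewrite map_inj_uniq ?enum_uniq //; exact: node_inj.
rewrite size_map size_enum_ord.
apply: leq_trans (size_polyD _ _) _; rewrite geq_max size_polyN hp andbT.
apply: leq_trans (size_sum _ _ _) _; apply/bigmax_leqP => i _.
by apply: leq_trans (size_scale_leq _ _) _; exact: size_L_poly.
Qed.

Lemma node_polyE N (k : 'I_N -> int) :
  node_poly k = \prod_(z <- [seq node k i | i <- enum 'I_N]) ('X - z%:P).
Proof. by rewrite big_map big_enum. Qed.

Lemma size_node_poly N (k : 'I_N -> int) : size (node_poly k) = N.+1.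
Proof. by rewrite node_polyE size_prod_XsubC size_map size_enum_ord. Qed.

Lemma node_poly_lead N (k : 'I_N -> int) : (node_poly k)`_N = 1.
Proof.
have /monicP : node_poly k \is monic by rewrite node_polyE monic_prod_XsubC.
by rewrite lead_coefE size_node_poly.
Qed.

(** Vieta's formula for the sum of the roots. *)
Lemma node_poly_sublead N (k : 'I_N.+1 -> int) :
  (node_poly k)`_N = - \sum_(i < N.+1) node k i.
Proof.
rewrite node_polyE.
have := @coefPn_prod_XsubC R [seq node k i | i <- enum 'I_N.+1].
by rewrite size_map size_enum_ord => ->; rewrite ?big_map ?big_enum.
Qed.

Lemma node_poly_root N (k : 'I_N -> int) i : (node_poly k).[node k i] = 0.
Proof. by rewrite horner_prod (bigD1 i) //= hornerXsubC subrr mul0r. Qed.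

Lemma size_P_poly N (k : 'I_N -> int) : (size (P_poly k) <= N)%N.
Proof.
apply/leq_sizeP => j; rewrite leq_eqVlt => /orP [/eqP <-|Nj].
  by rewrite coefB coefXn eqxx node_poly_lead subrr.
by rewrite coefB coefXn gtn_eqF // nth_default ?subr0 // size_node_poly.
Qed.

Lemma size_Q_poly N (k : 'I_N -> int) : (0 < N)%N -> (size (Q_poly k) <= N)%N.
Proof.
case: N k => // N k _; apply/leq_sizeP => j.
rewrite /Q_poly mulrDl coefB coefXn coefD coefXM coefCM.
(* With [N.+1] nodes the critical degrees are [N.+1], where Vieta's formula makes the two products
   with [node_poly k] cancel, and [N.+2], where the leading terms cancel. *)
rewrite leq_eqVlt => /orP [/eqP <-|].
  rewrite ltn_eqF //= node_poly_lead node_poly_sublead mulr1.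
  by rewrite addNr subr0.
case: j => // j; rewrite ltnS leq_eqVlt => /orP [/eqP <-|Nj].
  by rewrite eqxx node_poly_lead nth_default ?size_node_poly // mulr0 addr0 subrr.
by rewrite gtn_eqF // !nth_default ?size_node_poly // ?mulr0 ?addr0 ?subr0 // ltnW.
Qed.

(** * Interpolated derivatives of monomials *)

Definition moment N (k : 'I_N -> int) (q l : nat) : R :=
  \sum_(i < N) ((L_poly k i)^`(q)).[0] * node k i ^+ l.

(** By uniqueness, [p] is the interpolant of the monomial; differentiation and evaluation at 0 are
    linear. *)
Lemma moment_interp N (k : 'I_N -> int) (q l : nat) (p : {poly R}) :
  injective k -> (size p <= N)%N -> (forall i, p.[node k i] = node k i ^+ l) ->
  moment k q l = (p^`(q)).[0].
Proof.
move=> hk hp hv; rewrite -[p in RHS](lagrange_interpolation hk hp).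
rewrite linear_sum horner_sum; apply: eq_bigr => i _.
by rewrite linearZ hornerZ hv mulrC.
Qed.

(** Such a monomial is its own interpolant. At 0 its derivative of order [q] vanishes for [l < q] by
    the falling factorial, and for [q < l] by the remaining power of the variable. *)
Lemma moment_lt N (k : 'I_N -> int) (q l : nat) :
  injective k -> (l < N)%N -> moment k q l = l`!%:R *+ (l == q).
Proof.
move=> hk lN; rewrite (@moment_interp _ _ _ _ 'X^l) ?size_polyXn //; last first.
  by move=> i; rewrite hornerXn.
rewrite derivnXn hornerMn hornerXn expr0n.
have [lq|ql] := ltnP l q; first by rewrite ffact_small // (ltn_eqF lq) !mulr0n.
rewrite subn_eq0; case: (eqVneq l q) ql => [->|lq] ql.
  by rewrite leqnn ffactnn.
by rewrite leqNgt ltn_neqAle eq_sym lq ql mul0rn mulr0n.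
Qed.

(** Subtracting a multiple of [node_poly k] leaves the values at the nodes unchanged; the same
    argument gives Q. *)
Lemma moment_P N (k : 'I_N -> int) (q : nat) :
  injective k -> moment k q N = ((P_poly k)^`(q)).[0].
Proof.
move=> hk; apply: moment_interp => //; first exact: size_P_poly.
by move=> i; rewrite hornerD hornerN hornerXn node_poly_root subr0.
Qed.

Lemma moment_Q N (k : 'I_N -> int) (q : nat) : (0 < N)%N ->
  injective k -> moment k q N.+1 = ((Q_poly k)^`(q)).[0].
Proof.
move=> N0 hk; apply: moment_interp => //; first exact: size_Q_poly.
by move=> i; rewrite hornerD hornerN hornerXn hornerM node_poly_root mulr0 subr0.
Qed.

(** * Replacing the solution by its smooth extension *)

Lemma smooth_at_initial_box u x : smooth_at_initial u x ->
  exists (v : R -> R -> R) (d : posreal), smooth_on (box x d) v /\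
    forall y t, box x d y t -> 0 <= t -> u y t = v y t.
Proof.
move=> [v [hv huv]]; exists v; have [d hd] := locally_2d_and _ _ _ _ hv huv.
have hbox y t : box x d y t ->
    (forall q, ex_diff_n v q y t) /\ (0 <= t -> u y t = v y t).
  by move=> [h1 h2]; apply: hd h1 _; rewrite RminusE subr0.
by exists d; split=> y t /hbox [].
Qed.

(** For [0 < t] the functions [u] and [v] agree near each point of the box, so their derivatives
    agree and the equation passes from [u] to [v]. *)
Lemma smooth_pde_box a m u x : smooth_at_initial u x -> solves_pde a m u x ->
  exists (v : R -> R -> R) (d : posreal),
    [/\ smooth_on (box x d) v,
        forall y t, box x d y t -> 0 <= t -> u y t = v y t &
        eq_on (upper_box x d) (Dt v) (fun y t => a * iter m Dx v y t)].
Proof.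
move=> [v [hv huv]] hpde; exists v.
have [d hd] := locally_2d_and _ _ _ _ (locally_2d_and _ _ _ _ hv huv) hpde.
have hbox y t : box x d y t ->
    (forall q, ex_diff_n v q y t) /\ (0 <= t -> u y t = v y t) /\
    (0 < t -> Derive (fun tau => u y tau) t = a * Derive_n (fun z => u z t) m y).
  move=> [h1 h2]; have ht : Rlt (Rabs (Rminus t 0)) d by rewrite RminusE subr0.
  by have [[]] := hd y t h1 ht.
exists d; split.
- by move=> y t /hbox [].
- by move=> y t /hbox [_ []].
have huv' : eq_on (upper_box x d) v u.
  by move=> y t [/hbox [_ [h _]] /RltP t0]; rewrite h // ltW.
move=> y t yt; have hO := @open2_upper_box x d.
rewrite (eq_on_Dt hO huv' yt) (eq_on_iter_Dx m hO huv' yt).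
have [/hbox [_ [_ h]] /RltP t0] := yt.
by rewrite /Dt h // Derive_n_Dx.
Qed.

(** * Calculus of one-sided O-estimates at 0 *)

Lemma bigO0_ext f g p :
  at_right 0 (fun h => f h = g h) -> bigO0 f p -> bigO0 g p.
Proof.
move=> hfg [C hC]; exists C.
by apply: filter_imp (filter_and _ _ hfg hC) => h [<-].
Qed.

(** Powers decrease in the exponent once [h <= 1], whence the radius [Rmin e 1]; passing to the
    absolute value of [C] avoids a discussion of its sign. *)
Lemma bigO0_leq f p q : (p <= q)%N -> bigO0 f q -> bigO0 f p.
Proof.
move=> pq [C hC]; exists `|C|; have [e he] := hC.
have h0 : Rlt 0 (Rmin e 1) by apply: Rmin_case; [exact: cond_pos|exact: Rlt_0_1].
exists (mkposreal _ h0) => h hh /RltP h_gt0.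
have {}hh : Rlt (Rabs (h - 0)) (Rmin e 1) by exact: hh.
have h1 : h <= 1.
  rewrite ltW //; apply: le_lt_trans (ler_norm _) _; apply/RltP.
  by rewrite -RabsE -[X in Rabs X]subr0; exact: Rlt_le_trans hh (Rmin_r _ _).
apply: le_trans (he h _ _) _; last 1 first.
- apply: le_trans (ler_wpM2r _ (ler_norm C)) _; first by rewrite exprn_ge0 // ltW.
  by rewrite ler_wpM2l // ler_wiXn2l // ltW.
- exact: Rlt_le_trans hh (Rmin_l _ _).
- exact/RltP.
Qed.

Lemma bigO0_add f g p : bigO0 f p -> bigO0 g p -> bigO0 (fun h => f h + g h) p.
Proof.
move=> [C hC] [D hD]; exists (C + D).
apply: filter_imp (filter_and _ _ hC hD) => h [hf hg].
by apply: le_trans (ler_normD _ _) _; rewrite mulrDl lerD.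
Qed.

Lemma bigO0_scale c f p : bigO0 f p -> bigO0 (fun h => c * f h) p.
Proof.
move=> [C hC]; exists (`|c| * C).
by apply: filter_imp hC => h hf; rewrite normrM -mulrA ler_wpM2l.
Qed.

Lemma bigO0_opp f p : bigO0 f p -> bigO0 (fun h => - f h) p.
Proof.
by move=> [C hC]; exists C; apply: filter_imp hC => h hf; rewrite normrN.
Qed.

Lemma bigO0_exp p : bigO0 (fun h => h ^+ p) p.
Proof.
exists 1; exists (mkposreal 1 Rlt_0_1) => h _ /RltP h0.
by rewrite mul1r ger0_norm // exprn_ge0 // ltW.
Qed.

Lemma bigO0_sum (I : finType) (f : I -> R -> R) p :
  (forall i, bigO0 (f i) p) -> bigO0 (fun h => \sum_i f i h) p.
Proof.
move=> hf.
suff: bigO0 (fun h => \sum_(i <- index_enum I) f i h) p by [].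
elim: (index_enum I) => [|i s hs].
  exists 0; exists (mkposreal 1 Rlt_0_1) => h _ _.
  by rewrite big_nil normr0 mul0r.
apply: bigO0_ext (bigO0_add (hf i) hs).
by exists (mkposreal 1 Rlt_0_1) => h _ _; rewrite big_cons.
Qed.

(** * Taylor expansions of the solution in space and in time *)

Lemma taylor_bigO0 (f : R -> R) (p : nat) : smooth_near0 f ->
  bigO0 (fun h => f h - \sum_(0 <= l < p.+1) h ^+ l / l`!%:R * Derive_n f l 0)
    p.+1.
Proof.
move=> /(taylor_bound p) [C hC]; exists C; apply: filter_imp hC => h /RleP.
rewrite RabsE RpowE sum_f_R0E.
by under eq_bigr do rewrite RpowE factE INRE.
Qed.

(** Space derivatives at t = 0 only see values on the initial line, where [u] and its extension
    coincide. *)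
Lemma dx0_near (u v : R -> R -> R) (x : R) (d : posreal) l :
  (forall y t, box x d y t -> 0 <= t -> u y t = v y t) ->
  dx0 u l x = iter l Dx v x 0.
Proof.
move=> huv; rewrite -Derive_n_Dx; apply: Derive_n_ext_loc.
exists d => y hy; apply: huv => //; split; first exact: hy.
by rewrite Rabs_R0; exact: cond_pos.
Qed.

Lemma space_taylor u x c p : smooth_at_initial u x ->
  bigO0 (fun h => u (x + c * h) 0
    - \sum_(0 <= l < p.+1) (c * h) ^+ l / l`!%:R * dx0 u l x) p.+1.
Proof.
move=> /smooth_at_initial_box [v [d [hv huv]]].
have b0 y : Rlt (Rabs (y - x)) d -> box x d y 0.
  by move=> hy; split; rewrite ?Rabs_R0 //; exact: cond_pos.
have [|e he] := @smooth_affine (fun y => v y 0) c x d.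
  by move=> y l /b0 /(ex_derive_n_Dx _ hv).
have hs : smooth_near0 (fun h => v (c * h + x) 0).
  by exists e => h hh l; have [_ []] := he h l hh.
apply: bigO0_ext (taylor_bigO0 p hs).
exists e => h hh _; have [//|ch _] := he h 0%N.
  by rewrite -[h]subr0; exact: hh.
rewrite [x + _]addrC huv //; last by apply: b0; rewrite RminusE addrK.
congr (_ - _); apply: eq_bigr => l _.
have [|_ [_ ->]] := he 0 l; first by rewrite Rabs_R0; exact: cond_pos.
rewrite (dx0_near _ huv) Derive_n_Dx RpowE.
rewrite RplusE !RmultE mulr0 add0r exprMn.
by rewrite mulrA (mulrC (h ^+ l / _)) mulrA.
Qed.

(** Taylor's formula is applied to the extension, which is smooth on both sides of t = 0; the
    boundary form of the equation converts its time derivatives, and only positive times return to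
    [u]. *)
Lemma time_taylor a m u x p :
  smooth_at_initial u x -> solves_pde a m u x ->
  bigO0 (fun t => u x t
    - \sum_(0 <= j < p.+1) (t * a) ^+ j / j`!%:R * dx0 u (j * m) x) p.+1.
Proof.
move=> hu hpde; have [v [d [hv huv hv_pde]]] := smooth_pde_box hu hpde.
have b0 t : Rlt (Rabs t) d -> box x d x t.
  by move=> ht; split=> //; rewrite Rminus_diag Rabs_R0; exact: cond_pos.
have hs : smooth_near0 (fun t => v x t).
  by exists d => t ht l; exact: ex_derive_n_Dt hv (b0 _ ht).
apply: bigO0_ext (taylor_bigO0 p hs).
exists d => t ht /RltP t0; rewrite huv ?(ltW t0) //; last first.
  by apply: b0; rewrite -[t]subr0; exact: ht.
congr (_ - _); apply: eq_bigr => j _.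
rewrite (dx0_near _ huv) Derive_n_Dt.
rewrite (iter_Dt_pde_boundary j (cond_pos d) hv hv_pde).
by rewrite RpowE RmultE exprMn mulrA -!mulrA (mulrCA _^-1).
Qed.

(* [moment k q l] is the q-th derivative at 0 of the interpolant of y^l, which is
   y^l itself for l < N, P for l = N and Q for l = N+1. *)
Lemma lagrange_deriv_expansion N (k : 'I_N -> int) (q : nat) (g : nat -> R) (h : R) :
  injective k -> (q < N)%N ->
  \sum_(i < N) ((L_poly k i)^`(q)).[0]
      * (\sum_(0 <= l < N.+2) (node k i * h) ^+ l / l`!%:R * g l)
  = h ^+ q * g q
    + h ^+ N * ((P_poly k)^`(q)).[0] * (g N / N`!%:R)
    + h ^+ N.+1 * ((Q_poly k)^`(q)).[0] * (g N.+1 / N.+1`!%:R).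
Proof.
move=> hk qN; have N0 := leq_ltn_trans (leq0n q) qN.
transitivity (\sum_(0 <= l < N.+2) h ^+ l * moment k q l * (g l / l`!%:R)).
  rewrite (eq_bigr _ (fun i _ => mulr_sumr _ _ _ _)) exchange_big /=.
  apply: eq_bigr => l _; rewrite /moment mulr_sumr mulr_suml.
  by apply: eq_bigr => i _; rewrite exprMn; ring.
(* The terms [l = N] and [l = N.+1] give P and Q; among the lower ones only [l = q] survives, its
   moment [q!] cancelling the Taylor denominator. *)
rewrite !big_nat_recr //= moment_P // moment_Q //; congr (_ + _ + _).
rewrite big_mkord (bigD1 (Ordinal qN)) //= big1 ?addr0 => [|i iq]; last first.
  by rewrite moment_lt // -[_ == q]/(i == Ordinal qN) (negbTE iq) mulr0n mulr0 mul0r.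
rewrite moment_lt // eqxx mulr1n -mulrA; congr (_ * _).
by rewrite mulrCA divff ?mulr1 // pnatr_eq0 -lt0n fact_gt0.
Qed.

(** * Assembly of the consistency estimates and of the error formula *)

Theorem theorem3 (m n N : nat) (hm : (1 <= m)%N) (hn : (1 <= n)%N)
    (hN : N = (n * m + 1)%N) (a : R)
    (k : 'I_N -> int) (hk : injective k)
    (u : R -> R -> R) (x : R)
    (hu : smooth_at_initial u x) (hpde : solves_pde a m u x) :
  (forall j : nat, (j <= n)%N ->
     bigO0 (fun dx =>
       \sum_(i < N) ((L_poly k i)^`(j * m)).[0] * u (x + node k i * dx) 0
       - dx ^+ (j * m) * dx0 u (j * m) x) (n * m + 1))
  /\
  (exists (r : nat -> R -> R) (rho : R -> R),
     (forall j : nat, (j <= n)%N -> bigO0 (r j) (N + 2)) /\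
     bigO0 rho (n + 2) /\
     forall dt dx : R, 0 < dt -> 0 < dx ->
       local_error m n a k u x dt dx =
         dx ^+ N
           * (\sum_(0 <= j < n.+1)
                nu a m dt dx ^+ j / j`!%:R * ((P_poly k)^`(j * m)).[0])
           * (dx0 u N x / N`!%:R)
       + dx ^+ (N + 1)
           * (\sum_(0 <= j < n.+1)
                nu a m dt dx ^+ j / j`!%:R * ((Q_poly k)^`(j * m)).[0])
           * (dx0 u (N + 1) x / (N + 1)`!%:R)
       - (dt * a) ^+ n.+1 * (dx0 u (n.+1 * m) x / (n.+1)`!%:R)
       + \sum_(0 <= j < n.+1) nu a m dt dx ^+ j / j`!%:R * r j dx
       + rho dt)
  /\
  (forall dt dx : R, 0 < dt -> 0 < dx ->
     truncation_error m n a k u x dt dx = local_error m n a k u x dt dx / dt).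
Proof.
have N0 : (0 < N)%N by rewrite hN addn1.
(* The choice of [N] enters here: [n * m + 1] is the least number of nodes exceeding every order
   [j * m]. *)
have jN j : (j <= n)%N -> (j * m < N)%N.
  by move=> jn; rewrite hN addn1 ltnS leq_mul2r jn orbT.
(* The interpolated derivative of the space Taylor remainder past degree [N.+1]. It depends on [dx]
   alone, so its O-constant is independent of [dt]. *)
set r := fun (j : nat) (dx : R) => \sum_(i < N) ((L_poly k i)^`(j * m)).[0]
  * (u (x + node k i * dx) 0
     - \sum_(0 <= l < N.+2) (node k i * dx) ^+ l / l`!%:R * dx0 u l x).
have hr j : bigO0 (r j) (N + 2).
  rewrite addn2; apply: bigO0_sum => i; apply: bigO0_scale.
  exact: space_taylor.
have expansion j dx : (j <= n)%N ->
    \sum_(i < N) ((L_poly k i)^`(j * m)).[0] * u (x + node k i * dx) 0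
    = dx ^+ (j * m) * dx0 u (j * m) x
      + dx ^+ N * ((P_poly k)^`(j * m)).[0] * (dx0 u N x / N`!%:R)
      + dx ^+ N.+1 * ((Q_poly k)^`(j * m)).[0] * (dx0 u N.+1 x / N.+1`!%:R)
      + r j dx.
  move=> /jN hj.
  rewrite -(lagrange_deriv_expansion (fun l => dx0 u l x) dx hk hj) -big_split /=.
  by apply: eq_bigr => i _; rewrite -mulrDr [X in _ = _ * X]addrC subrK.
split; [|split].
- move=> j hj; rewrite -hN.
  (* The P and Q terms have coefficients free of [dx], so the three error terms have orders N, N + 1
     and N + 2. *)
  set p := ((P_poly k)^`(j * m)).[0] * (dx0 u N x / N`!%:R).
  set q := ((Q_poly k)^`(j * m)).[0] * (dx0 u N.+1 x / N.+1`!%:R).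
  have hb : bigO0 (fun dx => p * dx ^+ N + q * dx ^+ N.+1 + r j dx) N.
    apply: bigO0_add; last exact: bigO0_leq (leq_addr 2 N) (hr j).
    apply: bigO0_add; apply: bigO0_scale; first exact: bigO0_exp.
    exact: bigO0_leq (leqnSn N) (@bigO0_exp _).
  apply: bigO0_ext hb; exists (mkposreal 1 Rlt_0_1) => dx _ _.
  by rewrite expansion // /p /q; ring.
(* The time expansion runs one index beyond the scheme: its term [j = n.+1] becomes the explicit
   time error, and the negated remainder is [rho]. *)
- exists r, (fun dt => - (u x dt
    - \sum_(0 <= j < n.+2) (dt * a) ^+ j / j`!%:R * dx0 u (j * m) x)).
  split=> [j _|]; first exact: hr.
  split; first by rewrite addn2; apply: bigO0_opp; exact: time_taylor.
  move=> dt dx _ dx_gt0; rewrite /local_error.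
  have -> : scheme m n a k u x dt dx = \sum_(0 <= j < n.+1)
      nu a m dt dx ^+ j / j`!%:R
      * \sum_(i < N) ((L_poly k i)^`(j * m)).[0] * u (x + node k i * dx) 0.
    rewrite /scheme (eq_bigr _ (fun i _ => mulr_suml _ _ _ _)) exchange_big /=.
    apply: eq_bigr => j _; rewrite mulr_sumr.
    by apply: eq_bigr => i _; rewrite mulrA.
  rewrite [in RHS]opprB [X in _ = _ + (X - _)]big_nat_recr //= !addn1.
  rewrite (eq_big_nat _ _ (F2 := fun j =>
      (dt * a) ^+ j / j`!%:R * dx0 u (j * m) x
      + dx ^+ N * (nu a m dt dx ^+ j / j`!%:R * ((P_poly k)^`(j * m)).[0])
        * (dx0 u N x / N`!%:R)
      + dx ^+ N.+1 * (nu a m dt dx ^+ j / j`!%:R * ((Q_poly k)^`(j * m)).[0])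
        * (dx0 u N.+1 x / N.+1`!%:R)
      + nu a m dt dx ^+ j / j`!%:R * r j dx)); last first.
    move=> j /andP [_ jn]; rewrite expansion //.
    (* The powers of [dx] in [nu] are absorbed, which needs [dx] nonzero; the main terms of the
       scheme thus become those of the time expansion and cancel. *)
    have -> : (dt * a) ^+ j = nu a m dt dx ^+ j * dx ^+ (j * m).
      rewrite /nu mulnC exprM -exprMn mulfVK // expf_neq0 //.
      by rewrite gt_eqF.
    ring.
  rewrite !big_split /= -!mulr_suml -!mulr_sumr.
  ring.
- move=> dt dx _ _; rewrite /truncation_error /local_error.
  by rewrite -mulrBl opprB addrA subrK.
Qed.
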